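(* Let $1<q\le 2$, $\gamma>0$ and $p:=\frac{q}{q-1}$. There is a constant $C_2(q,\gamma)$, depending only on $q$ and $\gamma$, such that the following holds. Let $X$ be a real uniformly smooth Banach space whose modulus of smoothness satisfies $\rho(u)\le\gamma u^q$, and let $\mathcal{D}\subset X$ be a nonempty system of elements such that $\|g\|\le 1$ for all $g\in\mathcal{D}$ and $g\in\mathcal{D}$ implies $-g\in\mathcal{D}$ (it is not assumed that the closed linear span of $\mathcal{D}$ is $X$). Let $\tau=\{t_k\}_{k=1}^\infty$ be a sequence with $t_k\in[0,1]$, $k=1,2,\dots$. Then for any $f\in X$ and any realization of the Weak Relaxed Greedy Algorithm with weakness sequence $\tau$ applied to $f$ with respect to $\mathcal{D}$, the residuals satisfy, for every $m\ge 1$, $$ \|f^{r,\tau}_m\|\le\inf_{\phi\in A_1(\mathcal{D})}\|f-\phi\|+C_2(q,\gamma)\left(1+\sum_{k=1}^m t_k^p\right)^{-1/p}. $$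
   Context: $A_1(\mathcal{D})$ denotes the closure in $X$ of the convex hull of $\mathcal{D}$. Modulus of smoothness: $\rho(u):=\sup_{\|x\|=\|y\|=1}\left(\tfrac12(\|x+uy\|+\|x-uy\|)-1\right)$. $X$ is uniformly smooth if $\lim_{u\to0}\rho(u)/u=0$. For nonzero $f\in X$, $F_f$ denotes a norming functional of $f$: $F_f\in X^*$, $\|F_f\|=1$, $F_f(f)=\|f\|$. Weak Relaxed Greedy Algorithm (WRGA) with weakness sequence $\tau=\{t_k\}_{k=1}^\infty$, $t_k\in[0,1]$. (The letter $r$ in superscripts is just a label.) Set $f^r_0:=f^{r,\tau}_0:=f$ and $G^r_0:=G^{r,\tau}_0:=0$. For each $m\ge1$, inductively: (1) $\varphi^r_m:=\varphi^{r,\tau}_m\in\mathcal{D}$ is any element satisfying $$F_{f^r_{m-1}}(\varphi^r_m-G^r_{m-1})\ge t_m\sup_{g\in\mathcal{D}}F_{f^r_{m-1}}(g-G^r_{m-1}).$$ (2) Find $0\le\lambda_m\le1$ such that $$\|f-((1-\lambda_m)G^r_{m-1}+\lambda_m\varphi^r_m)\|=\inf_{0\le\lambda\le1}\|f-((1-\lambda)G^r_{m-1}+\lambda\varphi^r_m)\|$$ and define $G^r_m:=G^{r,\tau}_m:=(1-\lambda_m)G^r_{m-1}+\lambda_m\varphi^r_m$. (3) Let $f^r_m:=f^{r,\tau}_m:=f-G^r_m$. A realization is any sequence of choices satisfying (1)–(3). If $f^r_{m-1}=0$ at some step, the norming functional is not defined and the algorithm stops; the claim concerns those $m$ for which $f^{r,\tau}_m$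 is produced. *)

(* Defs.v *)
From HB Require Import structures.
From mathcomp Require Import all_boot all_order all_algebra.
From mathcomp Require Import all_classical all_reals all_analysis.
Import Order.TTheory GRing.Theory Num.Theory.
Import numFieldNormedType.Exports.
Set Implicit Arguments.
Unset Strict Implicit.
Unset Printing Implicit Defensive.
Local Open Scope classical_set_scope.
Local Open Scope ring_scope.

(* sup and inf are the real-valued ones of the library. Where they are used,
   the sets are bounded on the relevant side (the functional in dual_norm being
   continuous), and nonempty, except that the modulus of smoothness of the zero
   space is sup set0 = 0. *)

Definition modulus_of_smoothness (R : realType) (X : normedModType R) (u : R)
    : R :=
  sup [set r | exists x y : X, [/\ `|x| = 1, `|y| = 1 &
                r = (`|x + u *: y| + `|x - u *: y|) / 2 - 1]].

Definition uniformly_smooth (R : realType) (X : normedModType R) : Prop :=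
  modulus_of_smoothness X u / u @[u --> 0^'] --> (0 : R).

Definition A1 (R : realType) (X : normedModType R) (D : set X) : set X :=
  closure (smallest (@convex_set R X) D).

Definition dist_to (R : realType) (X : normedModType R) (f : X) (A : set X)
    : R :=
  inf [set `|f - a| | a in A].

Definition dual_norm (R : realType) (X : normedModType R)
    (F : {linear X -> R^o}) : R :=
  sup [set `|F x| | x in [set x : X | `|x| <= 1]].

Definition norming_functional (R : realType) (X : normedModType R)
    (f : X) (F : {linear X -> R^o}) : Prop :=
  [/\ continuous F, dual_norm F = 1 & F f = `|f|].

(* One pass of the algorithm: G is the previous approximant, phi the selected
   element, lambda the relaxation parameter and G' the new approximant. *)
Definition WRGA_step (R : realType) (X : normedModType R) (D : set X)
    (f : X) (t : R) (G phi : X) (lambda : R) (G' : X) : Prop :=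
  [/\ D phi,
      exists2 F : {linear X -> R^o}, norming_functional (f - G) F &
        F (phi - G) >= t * sup [set F (g - G) | g in D],
      0 <= lambda <= 1,
      `|f - ((1 - lambda) *: G + lambda *: phi)| =
        inf [set `|f - ((1 - l) *: G + l *: phi)| | l in `[0, 1]] &
      G' = (1 - lambda) *: G + lambda *: phi].

(* The first m steps of a realization; that all of them were carried out means
   that the residuals f - G 0, ..., f - G (m - 1) do not vanish.
   Values of phi and lambda at 0, and of G, phi, lambda beyond m, are
   irrelevant. *)
Definition WRGA_realization (R : realType) (X : normedModType R) (D : set X)
    (tau : nat -> R) (f : X) (G phi : nat -> X) (lambda : nat -> R) (m : nat)
    : Prop :=
  G 0%N = 0 /\
  forall k, (1 <= k <= m)%N ->
    f - G k.-1 != 0 /\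
    WRGA_step D f (tau k) (G k.-1) (phi k) (lambda k) (G k).

(* Main.v *)
Require Import Defs.
From HB Require Import structures.
From mathcomp Require Import all_boot all_order all_algebra.
From mathcomp Require Import all_classical all_reals all_analysis.
From mathcomp Require Import ring lra.
Import Order.TTheory GRing.Theory Num.Theory.
Import numFieldNormedType.Exports.
Local Open Scope classical_set_scope.
Local Open Scope ring_scope.

(* Let d be the distance from f to A_1(D) and b_m = ||f - G_m|| - d, so b_0 <= 1
   because A_1(D) lies in the unit ball. The norming functional F of
   r = f - G_{m-1} satisfies sup_D F(g - G_{m-1}) >= b_{m-1}, and smoothness
   gives, for every k in [0, 1],
     b_m <= b_{m-1} - k t_m b_{m-1} + 2 ||r|| gamma (2 k / ||r||)^q.
   Since ||r|| >= b_{m-1}, optimizing in k yields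
   b_m <= b_{m-1} (1 - c t_m^p b_{m-1}^p) with c depending only on q and gamma,
   hence b_m^p (1 + c sum_{k <= m} t_k^p) <= 1 by induction, as long as
   b_m > 0. *)

(** * Convexity, duality and smoothness estimates for a single step *)

Section NormedSpace.
Context {R : realType} {X : normedModType R}.
Implicit Types (D : set X) (x y f g G : X) (F : {linear X -> R^o}).

(** A sublevel set of a continuous convex function is closed and convex, so once it contains [D] it
    contains [A1 D]. This is applied to the norm and to norming functionals. *)
Lemma A1_le D (N : X -> R) (M : R) : continuous N ->
  (forall x y (l : R), 0 <= l <= 1 ->
     N (l *: x + (1 - l) *: y) <= l * N x + (1 - l) * N y) ->
  (forall g, D g -> N g <= M) -> forall h, A1 D h -> N h <= M.
Proof.
move=> Nc Nconv NM h.
have cl : closed (N @^-1` [set z | z <= M]).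
  by move/continuous_closedP: Nc; apply; exact: closed_le.
suff /closureS : smallest (@convex_set R X) D `<=` N @^-1` [set z | z <= M].
  by move/closure_id: cl => <- /(_ h).
apply: smallest_sub => // x y l; rewrite !inE /= => xM yM.
have l01 : 0 <= l%:num <= 1 by rewrite ge0 le1.
apply: le_trans (Nconv x y _ l01) _.
have -> : M = l%:num * M + (1 - l%:num) * M by rewrite -mulrDl addrC subrK mul1r.
by case/andP: l01 => l0 l1; rewrite lerD// ler_wpM2l// subr_ge0.
Qed.

Lemma A1_nonempty D : D !=set0 -> A1 D !=set0.
Proof.
by move=> [g Dg]; exists g; apply: subset_closure; exact: (sub_smallest _ Dg).
Qed.

Lemma le_dist_to f (A : set X) (r : R) :
  A !=set0 -> (forall h, A h -> r <= `|f - h|) -> r <= dist_to f A.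
Proof.
move=> [h Ah] le_r; apply: lb_le_inf; first by exists `|f - h|, h.
by move=> _ [a Aa <-]; exact: le_r.
Qed.

Lemma dist_to_ge0 f (A : set X) : A !=set0 -> 0 <= dist_to f A.
Proof. by move=> A0; apply: le_dist_to. Qed.

Lemma norm_le_dist_A1 D f : D !=set0 -> (forall g, D g -> `|g| <= 1) ->
  `|f| <= dist_to f (A1 D) + 1.
Proof.
move=> D0 D1; rewrite -lerBlDr; apply: le_dist_to; first exact: A1_nonempty.
move=> h A1h.
have h1 : `|h| <= 1.
  move: h A1h; apply: A1_le => //; first exact: norm_continuous.
  move=> x y l /andP[l0 l1]; apply: le_trans (ler_normD _ _) _.
  by rewrite !normrZ (ger0_norm l0) ger0_norm ?subr_ge0.
rewrite lerBlDr; apply: le_trans (_ : `|f - h| + `|h| <= _); last exact: lerD.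
by rewrite -{1}(subrK h f) ler_normD.
Qed.

Lemma norming_le f F x : norming_functional f F -> F x <= `|x|.
Proof.
move=> [Fc F1 _]; have [->|x0] := eqVneq x 0; first by rewrite linear0 normr0.
(* The real supremum [dual_norm F] dominates its set only if that set is bounded above; continuity
   of [F] supplies a bound. *)
have /linear_boundedP/pinfty_ex_gt0 [M M0 FM] : bounded_near F (nbhs 0).
  exact/linear_bounded_continuous.
have nx : 0 < `|x| by rewrite normr_gt0.
have : `|F (`|x|^-1 *: x)| <= dual_norm F.
  apply: ub_le_sup; last first.
    exists (`|x|^-1 *: x) => //=.
    by rewrite normrZ normfV normr_id mulVf ?gt_eqF.
  exists M => _ [y /= y1 <-]; apply: le_trans (FM y) _.
  by rewrite -[leRHS]mulr1 ler_wpM2l// ltW.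
rewrite F1 linearZ /= => /(le_trans (ler_norm _)).
by rewrite /GRing.scale /= mulrC ler_pdivrMr// mul1r.
Qed.

Lemma modulus_of_smoothness_ge x y (u : R) : 0 <= u -> `|x| = 1 -> `|y| = 1 ->
  (`|x + u *: y| + `|x - u *: y|) / 2 - 1 <= modulus_of_smoothness X u.
Proof.
move=> u0 x1 y1; apply: ub_le_sup; last by exists x, y.
exists u => _ [a [b [a1 b1 ->]]].
have Hp := ler_normD a (u *: b); have Hm := ler_normB a (u *: b).
rewrite normrZ a1 b1 mulr1 (ger0_norm u0) in Hp Hm.
lra.
Qed.

(** Homogeneous form of the modulus bound: normalize [x] and [y], take [u = |y| / |x|], and multiply
    by [2 |x|]. Only an upper bound [K] for [|y|] is needed, since [u^q] increases with [u]. *)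
Lemma smooth_norm_le (q gamma : R) : 0 <= q -> 0 <= gamma ->
  (forall u : R, 0 < u -> modulus_of_smoothness X u <= gamma * u `^ q) ->
  forall x y (K : R), x != 0 -> `|y| <= K ->
  `|x + y| + `|x - y| <= 2 * `|x| + 2 * `|x| * (gamma * (K / `|x|) `^ q).
Proof.
move=> q0 gamma0 rho x y K x0 yK.
have nx : 0 < `|x| by rewrite normr_gt0.
have [->|y0] := eqVneq y 0.
  rewrite addr0 subr0 [leLHS](_ : _ = 2 * `|x|); last by lra.
  by rewrite lerDl mulr_ge0 ?mulr_ge0 ?powR_ge0.
have ny : 0 < `|y| by rewrite normr_gt0.
set u := `|y| / `|x|.
have u0 : 0 < u by rewrite divr_gt0.
have := modulus_of_smoothness_ge (`|x|^-1 *: x) (`|y|^-1 *: y) u (ltW u0).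
rewrite !normrZ !normfV !normr_id !mulVf ?gt_eqF// => /(_ erefl erefl).
have -> : u *: (`|y|^-1 *: y) = `|x|^-1 *: y.
  by rewrite scalerA /u mulrAC mulfV ?gt_eqF// mul1r.
rewrite -scalerDr -scalerBr !normrZ normfV normr_id -mulrDr.
move=> /le_trans /(_ (rho u u0)) H.
have uK : gamma * u `^ q <= gamma * (K / `|x|) `^ q.
  rewrite ler_wpM2l// ge0_ler_powR// ?nnegrE ?ler_wpM2r ?invr_ge0 ?(ltW u0)//.
  by rewrite divr_ge0// (le_trans _ yK).
have /(ler_wpM2l (ltW nx)) := le_trans H uK.
rewrite mulrBr mulr1 !mulrA mulfV ?gt_eqF// mul1r => H'.
lra.
Qed.

(** With [S] the supremum, [F <= S + F G] on [D] and hence on [A1 D]. So each [h] in [A1 D]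
    satisfies [|f - h| >= F (f - h) = |f - G| + F G - F h >= |f - G| - S]. *)
Lemma dual_sup_ge D f G F : D !=set0 -> (forall g, D g -> `|g| <= 1) ->
  norming_functional (f - G) F ->
  `|f - G| - dist_to f (A1 D) <= sup [set F (g - G) | g in D].
Proof.
move=> D0 D1 nF; set S := sup _; have [Fc _ FfG] := nF.
have FD g : D g -> F g <= S + F G.
  move=> Dg; rewrite -lerBlDr -linearB; apply: ub_le_sup; last by exists g.
  exists (1 + `|G|) => _ [h Dh <-]; apply: le_trans (norming_le _ _ _ nF) _.
  by apply: le_trans (ler_normB _ _) _; rewrite lerD2r D1.
rewrite lerBlDr -lerBlDl; apply: le_dist_to; first exact: A1_nonempty.
move=> h A1h; have Fh : F h <= S + F G.
  move: h A1h; apply: A1_le => // x y l _.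
  by rewrite linearD !linearZ.
have := norming_le _ _ (f - h) nF.
by move: FfG Fh; rewrite !linearB /=; lra.
Qed.

Lemma WRGA_step_le D f (t : R) G g (l : R) G' : WRGA_step D f t G g l G' ->
  forall k : R, 0 <= k <= 1 -> `|f - G'| <= `|f - G - k *: (g - G)|.
Proof.
move=> [_ _ _ + ->] k k01 => ->; apply: ge_inf.
  by exists 0 => _ [z _ <-].
exists k; first by rewrite /= in_itv.
congr (`| _ |); rewrite scalerBl scale1r scalerBr !opprD !opprK !addrA.
by rewrite -!addrA; congr (_ + (_ + _)); rewrite addrC.
Qed.

Lemma WRGA_step_norm_le1 D f (t : R) G g (l : R) G' :
  (forall g, D g -> `|g| <= 1) -> WRGA_step D f t G g l G' ->
  `|G| <= 1 -> `|G'| <= 1.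
Proof.
move=> D1 [/D1 g1 _ /andP[l0 l1] _ ->] G1.
apply: le_trans (ler_normD _ _) _.
rewrite !normrZ (ger0_norm l0) ger0_norm ?subr_ge0//.
by nra.
Qed.

(* The norming functional bounds |r + k (g - G)| from below, and smoothness
   turns this into an upper bound for the reflected vector r - k (g - G). *)
Lemma WRGA_step_descent (q gamma : R) D f (t : R) G g (l : R) G' :
  0 <= q -> 0 <= gamma ->
  (forall u : R, 0 < u -> modulus_of_smoothness X u <= gamma * u `^ q) ->
  D !=set0 -> (forall g, D g -> `|g| <= 1) -> 0 <= t ->
  f - G != 0 -> `|G| <= 1 -> WRGA_step D f t G g l G' ->
  forall k : R, 0 <= k <= 1 ->
  `|f - G'| <= `|f - G| - k * t * (`|f - G| - dist_to f (A1 D))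
    + 2 * `|f - G| * (gamma * (2 * k / `|f - G|) `^ q).
Proof.
move=> q0 gamma0 rho D0 D1 t0 r0 G1 step k k01.
apply: le_trans (WRGA_step_le _ _ _ _ _ _ _ step k k01) _.
have [Dg [F nF Fg] _ _ _] := step; have [k0 _] := andP k01.
(* The constant 2 arises because [g] and [G] both lie in the unit ball. *)
have yK : `|k *: (g - G)| <= 2 * k.
  rewrite normrZ (ger0_norm k0) mulrC ler_wpM2r//.
  by apply: le_trans (ler_normB _ _) _; have := D1 _ Dg; lra.
have := smooth_norm_le _ _ q0 gamma0 rho _ _ _ r0 yK.
have := norming_le _ _ (f - G + k *: (g - G)) nF.
have [_ _ FfG] := nF; rewrite linearD FfG linearZ /= -[_ *: _]/(_ * _).
have := ler_wpM2l t0 (dual_sup_ge _ _ _ _ D0 D1 nF) => /le_trans/(_ Fg).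
move=> /(ler_wpM2l k0); rewrite mulrA.
lra.
Qed.

End NormedSpace.

(** * Real recursions with power-type decrease *)

Section Recursion.
Context {R : realType}.
Implicit Types (a b c d t x y s : R).

Lemma powR_le1 x (r : R) : 0 <= r -> 0 <= x <= 1 -> x `^ r <= 1.
Proof.
move=> r0 /andP[x0 x1]; rewrite (_ : 1 = 1 `^ r); last by rewrite powR1.
by rewrite ge0_ler_powR// nnegrE.
Qed.

(** Here [a] stands for the residual norm, [b] and [b'] for its excess over the distance before and
    after a step. The chosen [k] makes the smoothness error at most half of the gain [k t b]; the
    remaining [k t b / 2] equals [c t^p b^(p+1)]. *)
Lemma greedy_constant_exists (q gamma : R) : 1 < q -> 0 < gamma ->
  let p := q / (q - 1) in
  exists2 c : R, 0 < c <= 1 & forall a b b' t,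
    0 < b <= 1 -> b <= a -> 0 <= t <= 1 ->
    (forall k, 0 <= k <= 1 ->
      b' <= b - k * t * b + 2 * a * (gamma * (2 * k / a) `^ q)) ->
    b' <= b * (1 - c * (t `^ p * b `^ p)).
Proof.
move=> q1 gamma0 p.
have q10 : 0 < q - 1 by rewrite subr_gt0.
have q0 : 0 < q by lra.
(* [K] absorbs the constants of the smoothness error; the maximum with 1 gives [(2 K)^-1 <= 1],
   which yields both [c <= 1] and [k <= 1]. *)
set K := Num.max 1 (2 * gamma * 2 `^ q).
have K1 : 1 <= K by rewrite le_max lexx.
have KK : 2 * gamma * 2 `^ q <= K by rewrite le_max lexx orbT.
have K20 : 0 < (2 * K)^-1 by rewrite invr_gt0; lra.
have K21 : (2 * K)^-1 <= 1 by rewrite invf_le1; lra.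
pose e := (q - 1)^-1.
have e0 : 0 < e by rewrite invr_gt0.
have pE : p = e + 1.
  by rewrite /p /e; field; exact: lt0r_neq0.
exists ((2 * K)^-1 `^ e / 2).
  rewrite divr_gt0 ?powR_gt0//= ler_pdivrMr// mul1r.
  apply: (@le_trans _ _ 1); last by lra.
  by rewrite powR_le1 ?K21 ?andbT// ltW.
move=> a b b' t /andP[b0 b1] ba /andP[t0 t1] Hk.
have a0 : 0 < a by lra.
(* [k] balances the linear gain against the smoothness error:
   [K k^(q-1) b^(-q) = t/2]. *)
set k := (2 * K)^-1 `^ e * (t `^ e * b `^ p).
have base : k = ((2 * K)^-1 * (t * b `^ q)) `^ e.
  rewrite !powRM ?mulr_ge0 ?powR_ge0//; last exact: ltW.
  by rewrite -powRrM.
have bq0 := powR_ge0 b q.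
have bq1 : b `^ q <= 1.
  by rewrite powR_le1 ?b1 ?andbT// ltW.
have k0 : 0 <= k by rewrite base powR_ge0.
have k1 : k <= 1.
  rewrite base; apply: powR_le1; first exact: ltW.
  rewrite !mulr_ge0 ?(ltW K20)//= -[leRHS]mulr1 ler_pM ?mulr_ge0 ?(ltW K20)//.
  by rewrite -[leRHS]mulr1 ler_pM.
have kq : k `^ (q - 1) = (2 * K)^-1 * (t * b `^ q).
  rewrite base -powRrM /e mulVf ?gt_eqF// powRr1//.
  by rewrite !mulr_ge0// ltW.
(* As [b <= a] and [q > 1], [a^(1-q) <= b^(1-q)], so the error is at most [K k^q b^(1-q)]. By [kq]
   this is exactly [k t b / 2]. *)
have err : 2 * a * (gamma * (2 * k / a) `^ q) <= k * t * b / 2.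
  have k20 : 0 <= 2 * k by exact: mulr_ge0.
  rewrite (@powRM _ (2 * k)) ?(@powRM _ 2) ?invr_ge0 ?(ltW a0)//.
  have -> : k `^ q = k * k `^ (q - 1) by rewrite mulr_powRB1.
  have aq : a * a^-1 `^ q = (a `^ (q - 1))^-1.
    rewrite -(mulr_powRB1 (ltW _) q0) ?invr_gt0// mulrA mulfV ?gt_eqF// mul1r.
    by rewrite -[a^-1]powR_inv1 ?ltW// -powRrM mulN1r powRN.
  have aqb : a * a^-1 `^ q <= (b `^ (q - 1))^-1.
    rewrite aq lef_pV2 ?posrE ?powR_gt0// ge0_ler_powR// ?nnegrE; exact: ltW.
  have -> : 2 * a * (gamma * (2 `^ q * (k * k `^ (q - 1)) * a^-1 `^ q))
     = (2 * gamma * 2 `^ q) * (k * k `^ (q - 1)) * (a * a^-1 `^ q) by ring.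
  apply: (@le_trans _ _ (K * (k * k `^ (q - 1)) * (b `^ (q - 1))^-1)).
    rewrite ler_pM// ?mulr_ge0 ?powR_ge0 ?invr_ge0//; try exact: ltW.
    by rewrite ler_wpM2r// mulr_ge0 ?powR_ge0.
  rewrite kq -(mulr_powRB1 (ltW b0) q0).
  have bn0 : b `^ (q - 1) != 0 by rewrite gt_eqF// powR_gt0.
  rewrite le_eqVlt; apply/orP; left; apply/eqP; field.
  by rewrite bn0 /=; lra.
have -> : b * (1 - (2 * K)^-1 `^ e / 2 * (t `^ p * b `^ p))
    = b - k * t * b / 2.
  by rewrite /k pE -(mulr_powRB1 t0 (_ : 0 < e + 1)) ?addrK//; [field; lra|lra].
by have := Hk k; rewrite k0 k1 => /(_ isT); lra.
Qed.

(** Put [x = b^p], [z = c s x] and [A = 1 + c S]. Since [p >= 1],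
    [b'^p <= x (1 - z)^p <= x (1 - z)]. Then [x (1 - z) (A + c s) = (1 - z) (x A + z) <= (1 - z) (1
    + z) <= 1]. *)
Lemma powR_descent (p : R) c b b' s S : 1 <= p -> 0 < b -> 0 < b' ->
  0 <= c <= 1 -> 0 <= s <= 1 -> 0 <= S ->
  b' <= b * (1 - c * (s * b `^ p)) ->
  b `^ p * (1 + c * S) <= 1 -> b' `^ p * (1 + c * (S + s)) <= 1.
Proof.
move=> p1 b0 b'0 /andP[c0 c1] /andP[s0 s1] S0 b'b.
set x := b `^ p in b'b * => xS.
have x0 : 0 < x by rewrite powR_gt0.
set z := c * (s * x) in b'b *.
set w := 1 - z in b'b *.
have cS0 : 0 <= c * S by rewrite mulr_ge0.
have cs0 : 0 <= c * s by rewrite mulr_ge0.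
have z0 : 0 <= z by rewrite !mulr_ge0// ltW.
(* Positivity of [b'] forces [z < 1]. *)
have w0 : 0 < w by rewrite -(pmulr_rgt0 _ b0); exact: lt_le_trans b'b.
have w1 : w <= 1 by rewrite /w; lra.
have p0 : 0 <= p by lra.
have xw : b' `^ p <= x * w.
  apply: (@le_trans _ _ ((b * w) `^ p)).
    by rewrite ge0_ler_powR// ?nnegrE ?mulr_ge0//; exact: ltW.
  rewrite powRM ?(ltW b0) ?(ltW w0)// ler_wpM2l ?(ltW x0)//.
  by rewrite ge1r_powR// w0.
apply: (@le_trans _ _ (x * w * (1 + c * (S + s)))).
  by rewrite ler_wpM2r// mulrDr; lra.
set A := 1 + c * S in xS *.
have -> : x * w * (1 + c * (S + s)) = (1 - z) * (x * A + z).
  by rewrite /w /A /z; ring.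
have z1 : z < 1 by rewrite -subr_gt0.
nra.
Qed.

(** Because [c <= 1], [c (1 + S) <= 1 + c S]; then take [p]-th roots. *)
Lemma powR_descent_bound (p : R) c b S : 1 <= p -> 0 < b -> 0 < c <= 1 ->
  0 <= S -> b `^ p * (1 + c * S) <= 1 ->
  b <= c `^ (- p^-1) * (1 + S) `^ (- p^-1).
Proof.
move=> p1 b0 /andP[c0 c1] S0 bS.
have p0 : 0 < p by lra.
have cS0 : 0 < c * (1 + S) by rewrite mulr_gt0//; lra.
have bp0 := powR_ge0 b p.
have bpS : b `^ p <= (c * (1 + S))^-1.
  rewrite -div1r ler_pdivlMr//; apply: le_trans bS.
  by rewrite ler_wpM2l// mulrDr mulr1 lerD2r.
rewrite -powRM ?(ltW c0)//; last by lra.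
have -> : b = (b `^ p) `^ p^-1.
  by rewrite -powRrM mulfV ?gt_eqF// powRr1 ?ltW.
rewrite -mulN1r powRrM powR_inv1 ?(ltW cS0)//.
by rewrite ge0_ler_powR ?nnegrE ?invr_ge0 ?(ltW p0) ?(ltW cS0).
Qed.

End Recursion.

Theorem theorem4p2 (R : realType) (q gamma : R)
    (hq : 1 < q <= 2) (hgamma : 0 < gamma) :
  let p := q / (q - 1) in
  exists C2 : R,
    forall (X : completeNormedModType R)
      (hX : uniformly_smooth X)
      (hrho : forall u : R, 0 < u ->
         modulus_of_smoothness X u <= gamma * u `^ q)
      (D : set X) (D_nonempty : D !=set0)
      (D_le1 : forall g : X, D g -> `|g| <= 1)
      (D_sym : forall g : X, D g -> D (- g))
      (tau : nat -> R) (htau : forall k : nat, (1 <= k)%N -> 0 <= tau k <= 1)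
      (f : X) (G phi : nat -> X) (lambda : nat -> R) (m : nat),
      (1 <= m)%N ->
      WRGA_realization D tau f G phi lambda m ->
      `|f - G m| <= dist_to f (A1 D)
        + C2 * (1 + \sum_(1 <= k < m.+1) tau k `^ p) `^ (- p^-1).
Proof.
move=> p; have /andP[q1 _] := hq.
have [c /andP[c0 c1] step_gain] := greedy_constant_exists _ _ q1 hgamma.
have p1 : 1 <= p by rewrite ler_pdivlMr ?subr_gt0// mul1r gerBl.
(* [c] was obtained from [q] and [gamma] alone, before the space is introduced. *)
exists (c `^ (- p^-1)) => X _ hrho D D0 D1 _ tau htau f G phi lambda m _ [G0 steps].
set d := dist_to f (A1 D).
have d0 : 0 <= d by apply: dist_to_ge0; exact: A1_nonempty.
pose S n := \sum_(1 <= k < n.+1) tau k `^ p.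
have S0 n : 0 <= S n by apply: sumr_ge0 => k _; exact: powR_ge0.
(* If the excess at [m] is not positive, the claim is immediate because the second term is
   nonnegative. *)
have [bm|bm] := lerP (`|f - G m| - d) 0.
  by apply: le_trans (_ : d <= _); [rewrite -subr_le0|
    rewrite lerDl mulr_ge0// powR_ge0].
rewrite -lerBlDl; apply: powR_descent_bound; rewrite ?c0 ?c1 ?S0//.
(* The first clause keeps [|g - G n| <= 2], the second supplies the [b <= 1] needed for an
   admissible [k]. The third is conditional on a positive excess; since residual norms decrease,
   positivity at [n.+1] gives positivity at [n]. *)
suff inv n : (n <= m)%N -> [/\ `|G n| <= 1, `|f - G n| - d <= 1 &
    0 < `|f - G n| - d -> (`|f - G n| - d) `^ p * (1 + c * S n) <= 1].
  by have [_ _ /(_ bm)] := inv m (leqnn m).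
elim: n => [_|n IHn nm].
  have b1 : `|f - G 0%N| - d <= 1.
    by rewrite G0 subr0 lerBlDl; exact: norm_le_dist_A1.
  split=> // [|b0]; first by rewrite G0 normr0.
  rewrite /S big_geq// mulr0 addr0 mulr1.
  by apply: powR_le1; [lra|rewrite ltW].
have [G1 b1 invn] := IHn (ltnW nm).
have [r0 step] := steps n.+1 nm; rewrite /= in r0 step.
have /andP[t0 t1] := htau n.+1 isT.
have descent k (k01 : 0 <= k <= 1) := WRGA_step_descent _ _ _ _ _ _ _ _ _
  (ltW (lt_trans ltr01 q1)) (ltW hgamma) hrho D0 D1 t0 r0 G1 step k k01.
(* The competitor [k = 0] leaves the approximant unchanged. *)
have mono : `|f - G n.+1| <= `|f - G n|.
  have := WRGA_step_le _ _ _ _ _ _ _ step 0; rewrite scale0r subr0; apply.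
  by rewrite lexx ler01.
split=> [||b'0]; first exact: WRGA_step_norm_le1 step G1.
  by apply: le_trans b1; rewrite lerD2r.
have b0 : 0 < `|f - G n| - d by apply: lt_le_trans b'0 _; rewrite lerD2r.
rewrite /S big_nat_recr//=; apply: powR_descent (invn b0) => //.
- by rewrite c1 ltW.
- by rewrite powR_ge0 powR_le1 ?t0//; lra.
apply: (step_gain `|f - G n|); rewrite ?b0 ?t0//; first by rewrite gerBl.
by move=> k k01; have := descent k k01; rewrite -/d; lra.
Qed.
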